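(* A positive integer is twin-complete if and only if its squarefree part is twin-complete. A positive squarefree integer is twin-complete if and only if it can be written as a sum of at most two positive squares, but not as a sum of three positive squares.
   Context: Two vectors $x,y\in\mathbb{Z}^3$ are twins if they are nonzero, orthogonal and of equal Euclidean length. The norm of a vector is its squared length. A positive integer $M$ is twin-complete if every vector in $\mathbb{Z}^3$ with norm $M$ has a twin, and there exists a vector in $\mathbb{Z}^3$ with norm $M$ (i.e. $M$ is not of the form $4^a(8b+7)$). The squarefree part of $M$ is the unique squarefree $n$ with $M=nm^2$ for some integer $m$. *)

(* Defs.v *)
From mathcomp Require Import all_boot all_order all_algebra.

Set Implicit Arguments.
Unset Strict Implicit.
Unset Printing Implicit Defensive.

Definition dot (x y : 'rV[int]_3) : int := (\sum_i x 0 i * y 0 i)%R.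

(* The squared Euclidean length. *)
Definition norm (x : 'rV[int]_3) : int := dot x x.

(* Equal length is expressed as equality of the squared lengths. *)
Definition twins (x y : 'rV[int]_3) : Prop :=
  [/\ x != 0%R, y != 0%R, dot x y = 0%R & norm x = norm y].

Definition twin_complete (M : nat) : Prop :=
  (forall x : 'rV[int]_3, norm x = Posz M -> exists y, twins x y)
  /\ (exists x : 'rV[int]_3, norm x = Posz M).

(* This excludes n = 0, by taking d = 0. *)
Definition squarefree (n : nat) : Prop := forall d, d ^ 2 %| n -> d = 1.

Definition squarefree_part (M n : nat) : Prop :=
  squarefree n /\ exists m, M = n * m ^ 2.

Definition sum_of_pos_squares (k n : nat) : Prop :=
  exists a : 'I_k -> nat, (forall i, 0 < a i) /\ n = \sum_i a i ^ 2.

Lemma logn_squarefree n p : squarefree n -> prime p -> logn p n <= 1.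
Proof.
move=> sf pp; rewrite leqNgt; apply/negP => lt1.
have n0 : 0 < n by rewrite lt0n; apply: contraTneq lt1 => ->; rewrite logn0.
by have := prime_gt1 pp; rewrite (sf p) // pfactor_dvdn.
Qed.

Lemma squarefree_part_exists M : 0 < M -> exists n, squarefree_part M n.
Proof.
elim/ltn_ind: M => M IH M0.
case: (boolP [forall d : 'I_M.+1, (d ^ 2 %| M) ==> (d == 1 :> nat)]).
  move/forallP => sf; exists M; split; last by exists 1; rewrite muln1.
  move=> d dM; have ltd : d < M.+1.
    by rewrite ltnS; apply: leq_trans (dvdn_leq M0 dM); rewrite -mulnn; case: (d) => // e;
      rewrite leq_pmulr.
  by have /implyP/(_ dM)/eqP := sf (Ordinal ltd).
case/forallPn => -[d /= _]; rewrite negb_imply => /andP[/dvdnP[q Mq] d1].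
have [q0 d0] : 0 < q /\ 0 < d.
  by move: M0; rewrite Mq muln_gt0 expn_gt0 orbF => /andP.
have d2 : 1 < d by rewrite ltn_neqAle eq_sym d1.
have ltq : q < M by rewrite Mq ltn_Pmulr // -(exp1n 2) ltn_exp2r.
have [n [sf [m qm]]] := IH q ltq q0.
by exists n; split => //; exists (m * d); rewrite Mq qm expnMn mulnA.
Qed.

Lemma squarefree_part_unique M n n' : 0 < M ->
  squarefree_part M n -> squarefree_part M n' -> n = n'.
Proof.
have lognE k p : 0 < M -> squarefree_part M k -> prime p ->
    0 < k /\ logn p k = odd (logn p M) :> nat.
  move=> M0 [sf [m Mk]] pp; move: M0; rewrite Mk muln_gt0 => /andP[k0 m0].
  split => //; have := logn_squarefree sf pp.
  rewrite lognM // lognX oddD oddM /= addbF.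
  by case: (logn p k) => [|[]].
move=> M0 sn sn'; apply: eqn_from_log.
- by case: (lognE n 2 M0 sn).
- by case: (lognE n' 2 M0 sn').
move=> p; case: (boolP (prime p)) => [pp|np].
  by rewrite (lognE n p M0 sn pp).2 (lognE n' p M0 sn' pp).2.
by rewrite /logn (negbTE np).
Qed.

(* Main.v *)
(* By row-column orthogonality, a twin [w] of [x] with norm [n m^2], [n]
   squarefree, yields the integer vector [x * w / (n m)] (cross product) of norm
   [m^2] orthogonal to [x], and conversely such a vector [u] yields the twin
   [x * u / m].  For [m = 1] it is a unit coordinate vector, so that a vector of
   squarefree norm has a twin iff one of its coordinates vanishes.

   To pass between [n] and [n m^2] one prime factor [p] of [m] is treated at a
   time.  A vector [x] with [p^2 | norm x] is the image of an integer vector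
   under some integer matrix [R] with [R R^T = p^2], which transports orthogonal
   vectors: [R = p] if [p = 2] or [p | x], and otherwise [R] is [y |-> s y s^*]
   for a quaternion [s] of norm [p] generating the right ideal of all [s] with
   [p | x s], found by Lagrange's descent.  In the other direction, if [x R] is
   not divisible by the odd prime [p], then any [u] of norm [(p m)^2] orthogonal
   to [x R] pulls back to [p^2] times a vector of norm [m^2] orthogonal to [x];
   for [p = 2] one takes [2 x] instead. *)
Require Import Defs.
From mathcomp Require Import all_boot all_order all_algebra.
From mathcomp Require Import perm ring lra zify.
Set Implicit Arguments.
Unset Strict Implicit.
Unset Printing Implicit Defensive.
Import Order.TTheory GRing.Theory Num.Theory.
Local Open Scope ring_scope.

(** * Divisibility and integer quaternions *)

Lemma prime_dvdzM (p : nat) (a b : int) :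
  prime p -> (p %| a * b)%Z = (p %| a)%Z || (p %| b)%Z.
Proof. by move=> pp; rewrite !dvdzE abszM; exact: Euclid_dvdM. Qed.

Lemma prime_dvdz_sqr (p : nat) (a : int) :
  prime p -> (p %| a ^+ 2)%Z = (p %| a)%Z.
Proof. by move=> pp; rewrite expr2 prime_dvdzM // orbb. Qed.

Lemma odd_prime_dvdz2 (p : nat) (a : int) :
  prime p -> odd p -> (p %| 2 * a)%Z = (p %| a)%Z.
Proof.
move=> pp op; rewrite prime_dvdzM // [(p %| 2)%Z]dvdzE /= dvdn_prime2 //.
by case: eqP op => // ->.
Qed.

(** Integer coordinates give the Lipschitz quaternions. A centered remainder modulo an even [k] can
    have norm as large as [k^2], so the descent divides by odd [k] only and removes factors 2
    separately. *)
Record quat := Quat { q0 : int; q1 : int; q2 : int; q3 : int }.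

Definition qmul x y := Quat
  (q0 x * q0 y - q1 x * q1 y - q2 x * q2 y - q3 x * q3 y)
  (q0 x * q1 y + q1 x * q0 y + q2 x * q3 y - q3 x * q2 y)
  (q0 x * q2 y - q1 x * q3 y + q2 x * q0 y + q3 x * q1 y)
  (q0 x * q3 y + q1 x * q2 y - q2 x * q1 y + q3 x * q0 y).
Definition qadd x y :=
  Quat (q0 x + q0 y) (q1 x + q1 y) (q2 x + q2 y) (q3 x + q3 y).
Definition qconj x := Quat (q0 x) (- q1 x) (- q2 x) (- q3 x).
Definition qscale c x := Quat (c * q0 x) (c * q1 x) (c * q2 x) (c * q3 x).
Definition qnorm x := q0 x ^+ 2 + q1 x ^+ 2 + q2 x ^+ 2 + q3 x ^+ 2.
Definition qdvd (d : int) x :=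
  [&& (d %| q0 x)%Z, (d %| q1 x)%Z, (d %| q2 x)%Z & (d %| q3 x)%Z].

Ltac qring :=
  cbv [qnorm qadd qmul qconj qscale q0 q1 q2 q3]; try congr Quat; ring.

Lemma qmulA x y z : qmul x (qmul y z) = qmul (qmul x y) z.
Proof. by qring. Qed.

Lemma qmulZl c x y : qmul (qscale c x) y = qscale c (qmul x y).
Proof. by qring. Qed.

Lemma qmulZr c x y : qmul x (qscale c y) = qscale c (qmul x y).
Proof. by qring. Qed.

Lemma qmulDl x y z : qmul (qadd x y) z = qadd (qmul x z) (qmul y z).
Proof. by qring. Qed.

Lemma qmulDr x y z : qmul x (qadd y z) = qadd (qmul x y) (qmul x z).
Proof. by qring. Qed.

Lemma qmul0C x y : q0 (qmul x y) = q0 (qmul y x).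
Proof. by qring. Qed.

Lemma qnormM x y : qnorm (qmul x y) = qnorm x * qnorm y.
Proof. by qring. Qed.

Lemma qnormZ c x : qnorm (qscale c x) = c ^+ 2 * qnorm x.
Proof. by qring. Qed.

Lemma qnorm_conj x : qnorm (qconj x) = qnorm x.
Proof. by qring. Qed.

Lemma qmul_conjr x y : qmul (qmul x y) (qconj y) = qscale (qnorm y) x.
Proof. by qring. Qed.

Lemma qmul_conjl x y : qmul x (qmul (qconj x) y) = qscale (qnorm x) y.
Proof. by qring. Qed.

Lemma qscaleI c x y : c != 0 -> qscale c x = qscale c y -> x = y.
Proof.
case: x y => [x0 x1 x2 x3] [y0 y1 y2 y3] c0 [].
by do 4! move=> /(mulfI c0) ->.
Qed.

Lemma qdvdP d x : reflect (exists y, x = qscale d y) (qdvd d x).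
Proof.
apply: (iffP and4P) => [|[y ->]]; last by split; rewrite dvdz_mulr.
case: x => [x0 x1 x2 x3] /=.
case=> /dvdzP[a ->] /dvdzP[b ->] /dvdzP[c ->] /dvdzP[e ->].
by exists (Quat a b c e); rewrite /qscale /= ![d * _]mulrC.
Qed.

Lemma qdvd_mull d x y : qdvd d y -> qdvd d (qmul x y).
Proof.
by case/qdvdP=> z ->; apply/qdvdP; exists (qmul x z); rewrite qmulZr.
Qed.

Lemma qdvd_mulr d x y : qdvd d x -> qdvd d (qmul x y).
Proof.
by case/qdvdP=> z ->; apply/qdvdP; exists (qmul z y); rewrite qmulZl.
Qed.

Lemma qdvd_conj d x : qdvd d (qconj x) = qdvd d x.
Proof. by rewrite /qdvd /= !rpredN. Qed.

Lemma qdvd_add d x y : qdvd d x -> qdvd d y -> qdvd d (qadd x y).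
Proof.
case/qdvdP=> a -> /qdvdP[b ->]; apply/qdvdP; exists (qadd a b); qring.
Qed.

Lemma qdvdZ (p : nat) c x :
  prime p -> qdvd p (qscale c x) = (p %| c)%Z || qdvd p x.
Proof.
by move=> pp; rewrite /qdvd /= !(prime_dvdzM _ _ pp); case: (p %| c)%Z.
Qed.

(** Averaging the conjugates of [w] over the units 1, i, j, k kills its imaginary part. *)
Lemma qsum_units w y :
  let f z := qmul (qconj z) (qmul w (qmul z y)) in
  qadd (qadd (f (Quat 1 0 0 0)) (f (Quat 0 1 0 0)))
       (qadd (f (Quat 0 0 1 0)) (f (Quat 0 0 0 1)))
  = qscale (2 * (2 * q0 w)) y.
Proof. by qring. Qed.

(** Multiply [z t + conj (z t) = 2 Re (z t)] by [t] on the left. *)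
Lemma qmul_sandwich z t : qmul t (qmul z t) =
  qadd (qscale (2 * q0 (qmul z t)) t) (qscale (- qnorm t) (qconj z)).
Proof. by qring. Qed.

(** Modulo an odd prime the quaternions form a prime ring. If [p] does not divide [y], [qsum_units]
    with [w = u x] gives [p | Re (u x)] for all [u], and four units [u] read off the coordinates of
    [x]. *)
Lemma qdvd_sandwich (p : nat) x y : prime p -> odd p ->
  (forall z, qdvd p (qmul x (qmul z y))) -> qdvd p x \/ qdvd p y.
Proof.
move=> pp op H; case Dy: (qdvd p y); [by right | left].
have D u : (p %| q0 (qmul u x))%Z.
  have : qdvd p (qscale (2 * (2 * q0 (qmul u x))) y).
    by rewrite -qsum_units !qdvd_add // -qmulA; do 2! apply: qdvd_mull.
  by rewrite qdvdZ // Dy orbF !odd_prime_dvdz2.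
have [D0 D1 D2 D3] := And4 (D (Quat 1 0 0 0)) (D (Quat 0 (-1) 0 0))
                           (D (Quat 0 0 (-1) 0)) (D (Quat 0 0 0 (-1))).
move: D0 D1 D2 D3; rewrite /= !mul1r !mul0r !mulN1r !opprK !subr0 !add0r.
by move=> D0 D1 D2 D3; apply/and4P.
Qed.

(** By [qmul_sandwich], modulo [p], [t z t] is a multiple of [t], and [s t s] vanishes since
    [Re (t s) = 0]. So [(s t) z (t s) = s (t z t) s] is 0 for every [z]. *)
Lemma qdvd_swap (p : nat) s t : prime p -> odd p -> (p %| qnorm s)%Z ->
    (p %| qnorm t)%Z -> q0 (qmul s t) = 0 ->
  qdvd p (qmul s t) \/ qdvd p (qmul t s).
Proof.
move=> pp op Ns Nt Re; apply: qdvd_sandwich => // z.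
have -> : qmul (qmul s t) (qmul z (qmul t s)) =
          qmul s (qmul (qmul t (qmul z t)) s) by rewrite !qmulA.
rewrite (qmul_sandwich z t) qmulDl qmulDr; apply: qdvd_add; last first.
  by rewrite qdvd_mull // qdvd_mulr // qdvdZ // rpredN Nt.
rewrite qmulZl qmulZr (qmul_sandwich t s) (qmul0C t) Re mulr0 qdvdZ //.
apply/orP; right; apply: qdvd_add; first by rewrite qdvdZ // dvdz0.
by rewrite qdvdZ // rpredN Ns.
Qed.

(** * Lagrange's descent *)

Lemma odd_centered_rem (k : nat) (a : int) : odd k ->
  exists2 r : int, (k %| r - a)%Z & 4 * r ^+ 2 <= (k%:Z - 1) ^+ 2.
Proof.
move=> ok; have [h kE] : exists h : nat, k%:Z = 2 * h%:Z + 1.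
  by exists k./2; have := odd_double_half k; lia.
exists (((a + h%:Z) %% k)%Z - h%:Z).
  apply/dvdzP; exists (- ((a + h%:Z) %/ k)%Z).
  by have := divz_eq (a + h%:Z) k; lia.
have k0 : 0 < k%:Z by lia.
have ge0 := modz_ge0 (a + h%:Z) (lt0r_neq0 k0).
have lt := ltz_pmod (a + h%:Z) k0.
by move: (modz _ _) ge0 lt => m; rewrite kE => *; nia.
Qed.

(** The bound lies strictly below [k^2], which is what makes the descent decrease. *)
Lemma qcentered_rem (k : nat) x : odd k ->
  exists2 r, qdvd k (qadd r (qscale (-1) x)) & qnorm r <= (k%:Z - 1) ^+ 2.
Proof.
move=> ok.
have [a Da Ha] := odd_centered_rem (q0 x) ok.
have [b Db Hb] := odd_centered_rem (q1 x) ok.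
have [c Dc Hc] := odd_centered_rem (q2 x) ok.
have [e De He] := odd_centered_rem (q3 x) ok.
exists (Quat a b c e); last by rewrite /qnorm /=; lra.
by rewrite /qdvd /= !mulN1r Da Db Dc De.
Qed.

Lemma qnorm_ge0 x : 0 <= qnorm x.
Proof. by rewrite /qnorm !addr_ge0 // sqr_ge0. Qed.

Lemma qnorm_eq0 x : qnorm x = 0 -> x = Quat 0 0 0 0.
Proof. case: x => a b c d; rewrite /qnorm /= => /eqP.
rewrite !paddr_eq0 ?addr_ge0 ?sqr_ge0 // !sqrf_eq0.
by case/andP=> /andP[/andP[/eqP-> /eqP->] /eqP->] /eqP->. Qed.

Lemma qnorm_congr d x y :
  qdvd d (qadd x (qscale (-1) y)) -> (d %| qnorm x)%Z = (d %| qnorm y)%Z.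
Proof.
case/qdvdP=> z E.
have -> : x = qadd y (qscale d z).
  by rewrite -E; case: x {E} => *; case: y => *; qring.
suff [c ->] : exists c, qnorm (qadd y (qscale d z)) = qnorm y + d * c.
  by rewrite rpredDr // dvdz_mulr.
exists (2 * (q0 y * q0 z + q1 y * q1 z + q2 y * q2 z + q3 y * q3 z)
        + d * qnorm z); qring.
Qed.

(** An even norm has an even number of odd coordinates, so they split into two pairs with even sums;
    the pairing selects [u] among 1 + i, 1 + j, 1 + k. *)
Lemma qhalve s : (2 %| qnorm s)%Z ->
  exists u t, qmul s u = qscale 2 t /\ qnorm u = 2.
Proof.
case: s => s0 s1 s2 s3 even.
have e2 (a : int) : (2 %| a)%Z -> exists b, a = 2 * b.
  by case/dvdzP=> b ->; exists b; ring.
have : [\/ (2 %| s0 + s1)%Z /\ (2 %| s2 + s3)%Z,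
  (2 %| s0 + s2)%Z /\ (2 %| s1 + s3)%Z |
  (2 %| s0 + s3)%Z /\ (2 %| s1 + s2)%Z].
  have D (a b : int) : (2 %| a + b)%Z = ((2 %| a)%Z == (2 %| b)%Z) by lia.
  move: even; rewrite /qnorm /= !D !(@prime_dvdz_sqr 2) //.
  by do 4! case: (2 %| _)%Z => //; move=> _;
    by [apply: Or31 | apply: Or32 | apply: Or33].
case=> -[/e2[c Hc] /e2[d Hd]].
- exists (Quat 1 1 0 0), (Quat (s0 - c) c d (d - s2)); split => //.
  cbv [qmul qscale q0 q1 q2 q3]; congr Quat; lia.
- exists (Quat 1 0 1 0), (Quat (s0 - c) (s1 - d) c d); split => //.
  cbv [qmul qscale q0 q1 q2 q3]; congr Quat; lia.
- exists (Quat 1 0 0 1), (Quat (s0 - c) d (d - s1) c); split => //.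
  cbv [qmul qscale q0 q1 q2 q3]; congr Quat; lia.
Qed.

(* The descent takes place inside the right ideal of all [s] with [p | x s]. *)
Lemma qideal_descent (p : nat) x (k : nat) s : prime p ->
    (0 < k < p)%N -> qnorm s = k%:Z * p%:Z -> qdvd p (qmul x s) ->
  exists2 s', qnorm s' = p & qdvd p (qmul x s').
Proof.
move=> pp; elim/ltn_ind: k s => k IH s /andP[k0 kp] Ns Ds.
have [k1 | k1] := eqVneq k 1%N; first by exists s; rewrite // Ns k1 mul1r.
have [ok | ek] := boolP (odd k); last first.
  (* Multiplying by [u] doubles the norm and dividing by 2 quarters it, so [k] is halved. The case
     [p = 2] would force [k = 1]. *)
  have [h kE] : exists h : nat, k = h.*2 by exists k./2; rewrite even_halfK.
  have [|u [t [E Nu]]] := @qhalve s.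
    by rewrite Ns kE -mul2n PoszM dvdz_mulr // dvdz_mulr.
  apply: (IH h _ t); [lia | lia | |].
    by have := qnormZ 2 t; rewrite -E qnormM Ns Nu kE -mul2n; lia.
  move: Ds => /(qdvd_mulr u); rewrite -qmulA E qmulZr qdvdZ //.
  case/orP=> //; rewrite dvdzE /= dvdn_prime2 // => /eqP p2; lia.
have [r Dr Nr] := qcentered_rem s ok.
have /dvdzP[k' Nr'] : (k %| qnorm r)%Z.
  by rewrite (qnorm_congr Dr) Ns dvdz_mulr.
(* Otherwise [k | s], so [k^2] divides [k p] and [k | p], against [1 < k < p]. *)
have k'0 : k' != 0.
  apply/negP=> /eqP z0; move: Nr'; rewrite z0 mul0r => /qnorm_eq0 r0.
  have /qdvdP[z sE] : qdvd k s.
    by move: Dr; rewrite r0 /qdvd /= !add0r !mulN1r !rpredN.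
  have : (k %| p%:Z)%Z.
    rewrite -(@dvdz_mul2l k%:Z) ?eqz_nat -?lt0n //.
    by rewrite -Ns sE qnormZ -expr2 dvdz_mulr.
  rewrite dvdzE /= => /(prime_nt_dvdP pp k1) E; lia.
(* Since [r] is [s] modulo [k], this product is [qnorm s], hence 0, modulo [k]. The quotient [s']
   has norm [k' p] and stays in the right ideal because [k] is prime to [p]. *)
have : qdvd k (qmul s (qconj r)).
  have /qdvdP[z E] := Dr.
  have -> : r = qadd s (qscale k z).
    by rewrite -E; case: r {Dr Nr Nr' E} => *; case: s {Ns Ds} => *; qring.
  have -> : qmul s (qconj (qadd s (qscale k z))) =
      qadd (qscale (qnorm s) (Quat 1 0 0 0)) (qscale k (qmul s (qconj z))).
    by qring.
  by rewrite qdvd_add // /qdvd /= ?Ns !dvdz_mulr.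
case/qdvdP=> s' Es'.
have [l lE] : exists l : nat, k' = l.
  by exists `|k'|%N; have := qnorm_ge0 r; nia.
apply: (IH l _ s').
- have := qnorm_ge0 r; nia.
- have := qnorm_ge0 r; nia.
- apply: (@mulfI _ (k%:Z ^+ 2)); first by rewrite expf_neq0; lia.
  by rewrite -qnormZ -Es' qnormM qnorm_conj Ns Nr' lE; ring.
have : qdvd p (qscale k (qmul x s')).
  by rewrite -qmulZr -Es' qmulA qdvd_mulr.
rewrite qdvdZ // => /orP[|//]; rewrite dvdzE /= gtnNdvd //.
Qed.

(** The descent starts at the centered remainder of [qconj x] modulo [p]: it lies in the ideal
    because [x] times its conjugate is [qnorm x], and it is nonzero because [p] does not divide
    [x]. *)
Lemma qideal_generator (p : nat) x : prime p -> odd p ->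
    (p %| qnorm x)%Z -> ~~ qdvd p x ->
  exists2 s, qnorm s = p & qdvd p (qmul x s).
Proof.
move=> pp op Nx Dx.
have [s Ds Ns] := qcentered_rem (qconj x) op.
have /qdvdP[z E] := Ds.
have sE : s = qadd (qconj x) (qscale p z).
  by rewrite -E; case: s {Ds Ns E} => *; case: x {Nx Dx} => *; qring.
have /dvdzP[k' Nk] : (p %| qnorm s)%Z by rewrite (qnorm_congr Ds) qnorm_conj.
have k'0 : k' != 0.
  apply/negP=> /eqP k0; case/negP: Dx; rewrite -qdvd_conj.
  move: Nk; rewrite k0 mul0r => /qnorm_eq0 s0; move: Ds.
  by rewrite s0 /qdvd /= !add0r !mulN1r !rpredN.
have p1 := prime_gt1 pp.
have [k kE] : exists k : nat, k' = k.
  by exists `|k'|%N; have := qnorm_ge0 s; nia.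
apply: (@qideal_descent p x k s) => //; [nia | by rewrite Nk kE |].
have -> : qmul x s =
    qadd (qscale (qnorm x) (Quat 1 0 0 0)) (qscale p (qmul x z)).
  by rewrite sE; qring.
by rewrite qdvd_add // qdvdZ // ?Nx // dvdzz.
Qed.

(** As [x] is pure, [conj s * x] is, up to sign, the conjugate of [x s]; so it is [p t], and
    [x = s t]. Then [qdvd_swap] gives [t s = p y], and multiplying [s t s = p s y] by [conj s] on
    the right yields the factorization. *)
Lemma pure_quat_factor (p : nat) x : prime p -> odd p -> q0 x = 0 ->
    (p%:Z ^+ 2 %| qnorm x)%Z -> ~~ qdvd p x ->
  exists s y, [/\ qnorm s = p, q0 y = 0 & x = qmul s (qmul y (qconj s))].
Proof.
move=> pp op x0 Nx Dx.
have p0 : p%:Z != 0 by rewrite eqz_nat -lt0n prime_gt0.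
have Nx1 : (p %| qnorm x)%Z by apply: dvdz_trans Nx; rewrite dvdz_mulr.
have [s Ns Ds] := qideal_generator pp op Nx1 Dx.
have /qdvdP[t Et] : qdvd p (qmul (qconj s) x).
  have -> : qmul (qconj s) x = qscale (-1) (qconj (qmul x s)).
    by case: x x0 {Nx Dx Nx1 Ds} => a b c d /= ->; qring.
  by rewrite qdvdZ // qdvd_conj Ds orbT.
have xE : x = qmul s t.
  by apply: (qscaleI p0); rewrite -qmulZr -Et qmul_conjl Ns.
have Nt : (p %| qnorm t)%Z.
  by rewrite -(dvdz_mul2l p0) -[X in (_ %| X * _)%Z]Ns -qnormM -xE.
have Re : q0 (qmul s t) = 0 by rewrite -xE.
have Ns1 : (p %| qnorm s)%Z by rewrite Ns.
have [|/qdvdP[y yE]] := qdvd_swap pp op Ns1 Nt Re.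
  by rewrite -xE (negbTE Dx).
exists s, y; split=> //.
  by apply: (mulfI p0); move: Re; rewrite qmul0C yE /= mulr0.
apply: (qscaleI p0).
by rewrite -qmulZr -qmulZl -yE qmulA qmulA qmul_conjr Ns -xE.
Qed.

(** Pigeonhole: for [i, j <= (p - 1) / 2] the residues of [i^2] are distinct, and so are those of
    [-(1 + j^2)]; together these are [p + 1] values. *)
Lemma sum2sqrD1_mod (p : nat) : prime p -> odd p ->
  exists a b : nat, (p %| 1 + a ^ 2 + b ^ 2)%N.
Proof.
move=> pp op; have [h pE] : exists h, p = h.*2.+1.
  by exists p./2; have := odd_double_half p; rewrite op.
have p0 := prime_gt0 pp.
(* The factor [p.-1] plays the part of -1 modulo [p]. *)
pose f (u : 'I_h.+1 + 'I_h.+1) : 'I_p :=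
  match u with
  | inl i => Ordinal (ltn_pmod (i ^ 2) p0)
  | inr j => Ordinal (ltn_pmod (p.-1 * (1 + j ^ 2)) p0)
  end.
have : ~~ injectiveb f.
  apply/negP=> /injectiveP /leq_card; rewrite card_sum !card_ord; lia.
have sqrI (i j : 'I_h.+1) : i ^ 2 = j ^ 2 %[mod p] -> i = j.
  wlog ij : i j / (j <= i)%N => [W E|].
    by case: (leqP j i) => [/W|/ltnW/W]; [exact | move=> -> //].
  move/eqP; rewrite eqn_mod_dvd ?leq_sqr // subn_sqr Euclid_dvdM //.
  have [li lj] := (ltn_ord i, ltn_ord j).
  case: (posnP (i - j)%N) => [e _|gt0]; first by apply: val_inj => /=; lia.
  by case/orP=> /dvdn_leq; lia.
have negK c : (p.-1 * (1 + c) + (1 + c) = 0 %[mod p])%N.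
  by rewrite -mulSnr prednK // modnMr mod0n.
have mix (i j : 'I_h.+1) : i ^ 2 = p.-1 * (1 + j ^ 2) %[mod p] ->
    (p %| 1 + i ^ 2 + j ^ 2)%N.
  move=> E; rewrite [(1 + _)%N]addnC -addnA /dvdn -modnDml E modnDml.
  by rewrite negK mod0n.
case/injectivePn=> -[i|i] [[j|j] nij /(congr1 val) /= E].
- by case/eqP: nij; congr inl; apply: sqrI.
- by exists i, j; apply: mix.
- by exists j, i; apply: mix.
case/eqP: nij; congr inr; apply: sqrI.
have /eqP := negK (i ^ 2)%N.
rewrite -modnDml E modnDml -(negK (j ^ 2)%N) eqn_modDl eqn_modDl.
by move/eqP.
Qed.

(** * Integer similitudes of three-space *)

Lemma ord3P (P : 'I_3 -> Prop) : P 0 -> P 1 -> P 2 -> forall i, P i.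
Proof.
by move=> P0 P1 P2 [[|[|[|//]]] i3]; [move: P0 | move: P1 | move: P2];
  congr P; apply: val_inj.
Qed.

Lemma big_ord3 (F : 'I_3 -> int) : \sum_i F i = F 0 + F 1 + F 2.
Proof.
rewrite !big_ord_recr big_ord0 /= add0r.
by congr (F _ + F _ + F _); apply: val_inj.
Qed.

Lemma dotE x y : dot x y = (x *m y^T) 0 0.
Proof. by rewrite mxE; apply: eq_bigr => i _; rewrite mxE. Qed.

Lemma dot3E x y : dot x y = x 0 0 * y 0 0 + x 0 1 * y 0 1 + x 0 2 * y 0 2.
Proof. exact: big_ord3. Qed.

Lemma dotZl c x y : dot (c *: x) y = c * dot x y.
Proof. by rewrite !dot3E !mxE; ring. Qed.

Lemma dotZr c x y : dot x (c *: y) = c * dot x y.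
Proof. by rewrite !dot3E !mxE; ring. Qed.

Lemma normZ c x : norm (c *: x) = c ^+ 2 * norm x.
Proof. by rewrite /norm dotZl dotZr mulrA. Qed.

Lemma norm0 : norm 0 = 0.
Proof. by rewrite /norm dot3E !mxE. Qed.

Lemma dot_mulmx (A : 'M[int]_3) x y : dot (x *m A) y = dot x (y *m A^T).
Proof. by rewrite !dotE trmx_mul trmxK mulmxA. Qed.

Lemma dot_similitude (A : 'M[int]_3) c x y :
  A *m A^T = c%:M -> dot (x *m A) (y *m A) = c * dot x y.
Proof.
by move=> AA; rewrite dot_mulmx -mulmxA AA mul_mx_scalar dotZr.
Qed.

Definition vec3 (a b c : int) : 'rV[int]_3 := \row_j nth 0 [:: a; b; c] j.

Definition vdvd (d : int) (x : 'rV[int]_3) := [forall i, (d %| x ord0 i)%Z].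

Lemma vdvdP d x : reflect (exists y, x = d *: y) (vdvd d x).
Proof.
apply: (iffP forallP) => [D|[y ->] i]; last by rewrite mxE dvdz_mulr.
exists (\row_i (x ord0 i %/ d)%Z); apply/rowP=> i.
by rewrite !mxE mulrC divzK.
Qed.

Definition pure (x : 'rV[int]_3) := Quat 0 (x 0 0) (x 0 1) (x 0 2).

Lemma pure_inj : injective pure.
Proof. by move=> x y [e0 e1 e2]; apply/rowP; apply: ord3P. Qed.

Lemma pure_vec3 q : q0 q = 0 -> q = pure (vec3 (q1 q) (q2 q) (q3 q)).
Proof. by case: q => [a b c d] /= ->; rewrite /pure !mxE. Qed.

Lemma norm_pure x : norm x = qnorm (pure x).
Proof. by rewrite /norm dot3E /qnorm /=; ring. Qed.

Lemma vdvd_pure d x : vdvd d x = qdvd d (pure x).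
Proof.
apply/forallP/and4P => [D|[_ D1 D2 D3]]; last exact: ord3P.
by split; rewrite ?dvdz0 ?D.
Qed.

(** Row [i] is the image of the [i]-th imaginary unit under [y |-> s y (qconj s)]; the default of
    the first [nth] serves as the third unit. *)
Definition rotmx s : 'M[int]_3 := \matrix_(i, j)
  let e := nth (Quat 0 0 0 1) [:: Quat 0 1 0 0; Quat 0 0 1 0] i in
  let: Quat _ a b c := qmul s (qmul e (qconj s)) in nth 0 [:: a; b; c] j.

Lemma pure_rotmx x s :
  pure (x *m rotmx s) = qmul s (qmul (pure x) (qconj s)).
Proof.
case: s => [a b c d].
rewrite /pure !mxE !big_ord3 !mxE /=.
cbv [qmul qconj q0 q1 q2 q3]; congr Quat; ring.
Qed.

Lemma rotmx_tr s : (rotmx s)^T = rotmx (qconj s).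
Proof.
case: s => [a b c d]; apply/matrixP; apply: ord3P; apply: ord3P;
  rewrite !mxE /=; ring.
Qed.

Lemma rotmx_mul s : rotmx s *m (rotmx s)^T = (qnorm s ^+ 2)%:M.
Proof.
rewrite rotmx_tr; apply/row_matrixP => i; rewrite !rowE mulmxA mul_mx_scalar.
apply: pure_inj; rewrite !pure_rotmx; move: (delta_mx _ _) => x.
have -> : pure ((qnorm s ^+ 2) *: x) = qscale (qnorm s ^+ 2) (pure x).
  by rewrite /pure !mxE /qscale /= mulr0.
by case: s => a b c d; case: (pure x) => *; qring.
Qed.

(** Squares are 0 or 1 modulo 4. This settles the prime 2 in both directions. *)
Lemma sum3sqr_mod4 (a b c : int) : (4 %| a ^+ 2 + b ^+ 2 + c ^+ 2)%Z ->
  [/\ (2 %| a)%Z, (2 %| b)%Z & (2 %| c)%Z].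
Proof.
have sqr4 (d : int) : exists e, d ^+ 2 = 4 * e + (~~ (2 %| d)%Z)%:Z.
  case: (boolP (2 %| d)%Z) => [/dvdzP[e ->]|odd_d].
    by exists (e ^+ 2); rewrite /=; ring.
  have [e ->] : exists e, d = 2 * e + 1 by exists (d %/ 2)%Z; lia.
  by exists (e ^+ 2 + e); rewrite /=; ring.
have [[a' ->] [b' ->] [c' ->]] := And3 (sqr4 a) (sqr4 b) (sqr4 c).
by do 3! case: (2 %| _)%Z => /=; move=> H; split=> //; exfalso; lia.
Qed.

Lemma similitude_factor (p : nat) x : prime p -> (p%:Z ^+ 2 %| norm x)%Z ->
  exists (R : 'M[int]_3) x', R *m R^T = (p%:Z ^+ 2)%:M /\ x = x' *m R.
Proof.
move=> pp Nx.
have [/vdvdP[x' ->]|Dx] := boolP (vdvd p x).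
  exists p%:Z%:M, x'; rewrite mul_mx_scalar tr_scalar_mx -scalar_mxM -expr2.
  by split.
have op : odd p.
  case: (even_prime pp) => [p2|//]; case/negP: Dx.
  move: Nx; rewrite p2 /norm dot3E -!expr2 => /sum3sqr_mod4[D0 D1 D2].
  by apply/forallP; apply: ord3P.
have [s [y [Ns y0 E]]] : exists s y, [/\ qnorm s = p, q0 y = 0 &
    pure x = qmul s (qmul y (qconj s))].
  by apply: pure_quat_factor; rewrite -?norm_pure -?vdvd_pure.
exists (rotmx s), (vec3 (q1 y) (q2 y) (q3 y)).
rewrite rotmx_mul Ns; split=> //.
by apply: pure_inj; rewrite pure_rotmx -pure_vec3.
Qed.

Lemma exists_similitude (p : nat) : prime p -> odd p ->
  exists R : 'M[int]_3, [/\ R *m R^T = (p%:Z ^+ 2)%:M,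
    R^T *m R = (p%:Z ^+ 2)%:M & exists i j, ~~ (p %| R i j)%Z].
Proof.
move=> pp op; have [a [b D]] := sum2sqrD1_mod pp op.
(* The quaternion [1 + a i + b j] has norm divisible by [p] without being divisible itself. *)
have [|//|s Ns _] := @qideal_generator p (Quat 1 a b 0) pp op.
- rewrite /qnorm /=.
  case/dvdnP: D => c D; apply/dvdzP; exists c%:Z.
  by rewrite -PoszM -D; lia.
- by rewrite /qdvd /= dvdz1 absz_nat; move: (prime_gt1 pp); case: eqP => // ->.
exists (rotmx s); split.
- by rewrite rotmx_mul Ns.
- by have := rotmx_mul (qconj s); rewrite -rotmx_tr trmxK qnorm_conj Ns.
suff : ~~ [forall i, [forall j, (p %| rotmx s i j)%Z]].
  by case/forallPn=> i /forallPn[j Dij]; exists i, j.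
apply/negP=> /forallP D'.
have {}D' i j : (p %| rotmx s i j)%Z by move/forallP: (D' i).
(* Signed sums of the norm and the three diagonal entries are [4 s_i^2], so [p | s] and [p^2] would
   divide [qnorm s = p]. *)
have [D0 D1 D2] := And3 (D' 0 0) (D' 1 1) (D' 2 2).
have : qdvd p s.
  have key a' : (p %| 2 * (2 * a' ^+ 2))%Z -> (p %| a')%Z.
    by rewrite !odd_prime_dvdz2 // prime_dvdz_sqr.
  case: s Ns D0 D1 D2 {D'} => s0 s1 s2 s3 Ns; rewrite !mxE /= => D0 D1 D2.
  have DN : (p %| qnorm (Quat s0 s1 s2 s3))%Z by rewrite Ns dvdzz.
  apply/and4P; split; apply: key.
  - by have := rpredD DN (rpredD D0 (rpredD D1 D2)); congr (_ %| _)%Z;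
      rewrite /qnorm /=; ring.
  - by have := rpredB (rpredD DN D0) (rpredD D1 D2); congr (_ %| _)%Z;
      rewrite /qnorm /=; ring.
  - by have := rpredB (rpredD DN D1) (rpredD D0 D2); congr (_ %| _)%Z;
      rewrite /qnorm /=; ring.
  - by have := rpredB (rpredD DN D2) (rpredD D0 D1); congr (_ %| _)%Z;
      rewrite /qnorm /=; ring.
case/qdvdP=> z sE; move: Ns; rewrite sE qnormZ => E.
have p0 : p%:Z != 0 by rewrite eqz_nat -lt0n prime_gt0.
have : (p %| 1)%Z.
  rewrite -(dvdz_mul2l p0) mulr1 -[X in (_ %| X)%Z]E -expr2 dvdz_mulr //.
by rewrite dvdz1 absz_nat; case: eqP pp => // ->.
Qed.

(** * Twins and orthogonal vectors *)

Definition cross (x y : 'rV[int]_3) := vec3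
  (x 0 1 * y 0 2 - x 0 2 * y 0 1)
  (x 0 2 * y 0 0 - x 0 0 * y 0 2)
  (x 0 0 * y 0 1 - x 0 1 * y 0 0).

Lemma dot_crossl x y : dot x (cross x y) = 0.
Proof. by rewrite dot3E !mxE /=; ring. Qed.

Lemma norm_cross x y : norm (cross x y) = norm x * norm y - dot x y ^+ 2.
Proof. by rewrite /norm !dot3E !mxE /=; ring. Qed.

(* [x], [y] and [cross x y] are, up to scaling, the rows of an orthogonal
   matrix, whose columns are unit vectors as well. *)
Lemma cross_coord_sqr x y i : dot x y = 0 ->
  cross x y 0 i ^+ 2 =
    norm x * norm y - norm y * x 0 i ^+ 2 - norm x * y 0 i ^+ 2.
Proof.
move=> xy; suff -> : cross x y 0 i ^+ 2 =
    norm x * norm y - norm y * x 0 i ^+ 2 - norm x * y 0 i ^+ 2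
    - dot x y * (dot x y - 2 * x 0 i * y 0 i) by rewrite xy mul0r subr0.
by move: i; apply: ord3P; rewrite /norm !dot3E !mxE /=; ring.
Qed.

Lemma squarefree_gt0 n : squarefree n -> (0 < n)%N.
Proof.
move=> sf; rewrite lt0n; apply/eqP => n0.
by have := sf 0%N; rewrite n0 => /(_ isT).
Qed.

(** With [g] the gcd, [n = n' g] and [t = t' g], coprimality gives [n' | g]; so [n'^2 | n] and
    [n' = 1]. *)
Lemma squarefree_dvd_sqr n (t : int) :
  squarefree n -> (n %| t ^+ 2)%Z -> (n %| t)%Z.
Proof.
move=> sf; rewrite !dvdzE abszX /=; move: `|t|%N => {}t.
have n0 := squarefree_gt0 sf.
have g0 : (0 < gcdn n t)%N by rewrite gcdn_gt0 n0.
have [n' nE] := dvdnP (dvdn_gcdl n t).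
have [t' tE] := dvdnP (dvdn_gcdr n t).
have cop : coprime n' t'.
  by rewrite /coprime -(eqn_pmul2r g0) muln_gcdl -nE -tE mul1n.
move: (gcdn n t) g0 nE tE => g g0 nE ->.
rewrite {1}nE.
have -> : ((t' * g) ^ 2 = t' ^ 2 * g * g)%N by rewrite expnMn -mulnA.
rewrite dvdn_pmul2r // Gauss_dvdr ?coprimeXr // => D.
have n'1 : n' = 1%N by apply: sf; rewrite nE expnS expn1 dvdn_mul.
by rewrite nE n'1 mul1n dvdn_mull.
Qed.

(* Divided by [m], such a [u] is the direction of the third edge of the cube
   spanned by [x] and a twin. *)
Definition axis (m : int) (x : 'rV[int]_3) :=
  exists u, norm u = m ^+ 2 /\ dot x u = 0.

Lemma norm_gt0 x : 0 < norm x -> x != 0.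
Proof. by apply: contraTneq => ->; rewrite norm0. Qed.

Lemma twin_axis n m x : squarefree n -> (0 < m)%N ->
  norm x = (n * m ^ 2)%N -> (exists y, twins x y) <-> axis m x.
Proof.
move=> sf m0 Nx; have n0 := squarefree_gt0 sf.
have nz : n%:Z != 0 by rewrite eqz_nat -lt0n.
have mz : m%:Z != 0 by rewrite eqz_nat -lt0n.
have {}Nx : norm x = n%:Z * m%:Z ^+ 2 by rewrite Nx -mulnn !PoszM -expr2.
have Nx0 : 0 < norm x by rewrite Nx mulr_gt0 ?exprn_gt0.
split=> [[y [_ _ xy Nxy]]|[u [Nu xu]]].
  (* By [cross_coord_sqr] each squared coordinate is a multiple of [n m^2]; hence [m] divides the
     coordinate, and the squarefree [n] divides the quotient. *)
  have D : vdvd (n%:Z * m%:Z) (cross x y).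
    apply/forallP => i.
    have := cross_coord_sqr i xy; rewrite -Nxy Nx.
    move: (cross x y 0 i) => t E.
    have D2 : (n%:Z * m%:Z ^+ 2 %| t ^+ 2)%Z.
      by rewrite E !rpredB //; apply: dvdz_mulr; rewrite dvdzz.
    have : (m %| t)%Z.
      rewrite -(@dvdz_pexp2r _ _ 2) //.
      by apply: dvdz_trans D2; rewrite dvdz_mull.
    case/dvdzP=> s tE; rewrite tE dvdz_mul2r //.
    apply: squarefree_dvd_sqr => //.
    by move: D2; rewrite tE exprMn dvdz_mul2r ?expf_neq0.
  case/vdvdP: D => u cE; exists u; split.
    apply: (@mulfI _ ((n%:Z * m%:Z) ^+ 2)).
      by rewrite expf_neq0 ?mulf_neq0.
    by rewrite -normZ -cE norm_cross xy -Nxy Nx; ring.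
  apply: (@mulfI _ (n%:Z * m%:Z)); first by rewrite mulf_neq0.
  by rewrite -dotZr -cE dot_crossl mulr0.
have D : vdvd m (cross x u).
  apply/forallP => i; rewrite -(@dvdz_pexp2r _ _ 2) //.
  rewrite (cross_coord_sqr i xu) Nu Nx !rpredB //; first by rewrite dvdz_mull.
    by rewrite dvdz_mulr.
  by rewrite mulrAC dvdz_mull.
case/vdvdP: D => w cE.
have Nw : norm x = norm w.
  apply: (@mulfI _ (m%:Z ^+ 2)); first by rewrite expf_neq0.
  by rewrite -[RHS]normZ -cE norm_cross xu Nu; ring.
exists w; split=> //; [exact: norm_gt0 | by apply: norm_gt0; rewrite -Nw |].
by apply: (mulfI mz); rewrite -dotZr -cE dot_crossl mulr0.
Qed.

Lemma axis1 x : axis 1 x <-> exists i, x 0 i = 0.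
Proof.
split=> [[u [Nu xu]]|[i xi]]; last first.
  exists (delta_mx 0 i); split.
    by move: i {xi}; apply: ord3P; rewrite /norm dot3E !mxE.
  move: i xi; apply: ord3P => E; rewrite dot3E !mxE /= E; ring.
have [u0 | u0] := eqVneq (u 0 0) 0; last first.
  exists 0; move: Nu xu; rewrite /norm !dot3E => Nu xu.
  have [u1 u2] : u 0 1 = 0 /\ u 0 2 = 0 by split; nia.
  apply/eqP; move/eqP: xu.
  by rewrite u1 u2 !mulr0 !addr0 mulf_eq0 (negbTE u0) orbF.
have [u1 | u1] := eqVneq (u 0 1) 0; last first.
  exists 1; move: Nu xu; rewrite /norm !dot3E => Nu xu.
  have u2 : u 0 2 = 0 by nia.
  apply/eqP; move/eqP: xu.
  by rewrite u0 u2 !mulr0 addr0 add0r mulf_eq0 (negbTE u1) orbF.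
exists 2; move: Nu xu; rewrite /norm !dot3E u0 u1 !mulr0 !add0r => Nu /eqP.
by rewrite mulf_eq0 => /orP[/eqP //|/eqP u2]; move: Nu; rewrite u2.
Qed.

(** Modulo [p], a totally isotropic subspace of three-space is at most a line, so [y] is a multiple
    of [h]; being orthogonal to [x], which [h] is not, it vanishes. *)
Lemma isotropic_orthogonal (p : nat) h y x : prime p ->
    (p %| norm h)%Z -> (p %| norm y)%Z -> (p %| dot h y)%Z ->
    (p %| dot x y)%Z -> ~~ (p %| dot h x)%Z -> vdvd p y.
Proof.
move=> pp Hh Hy Hhy Hxy Hhx.
have reg a : (p %| dot h x * a)%Z -> (p %| a)%Z.
  by rewrite prime_dvdzM // (negbTE Hhx).
(* The square of this triple product is the Gram determinant of [h], [y], [x]. *)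
have Dx : (p %| dot x (cross h y))%Z.
  rewrite -prime_dvdz_sqr //.
  have -> : dot x (cross h y) ^+ 2 =
    norm h * (norm y * norm x - dot x y ^+ 2)
    + dot h y * (2 * dot h x * dot x y - dot h y * norm x)
    - norm y * dot h x ^+ 2.
    by rewrite /norm !dot3E !mxE /=; ring.
  by rewrite rpredB ?rpredD // dvdz_mulr.
have Dc i : (p %| cross h y 0%R i)%Z.
  apply: reg; have -> : dot h x * cross h y 0 i = dot x (cross h y) * h 0 i
      + norm h * cross x y 0 i - dot h y * cross x h 0 i.
    by move: i; apply: ord3P; rewrite /norm !dot3E !mxE /=; ring.
  by rewrite rpredB ?rpredD // dvdz_mulr.
case/vdvdP: (introT forallP Dc : vdvd p _) => c cE.
apply/forallP=> i; apply: reg.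
(* This is the expansion of the triple cross product. *)
have -> : dot h x * y 0 i = dot x y * h 0 i - cross x (cross h y) 0 i.
  by move: i; apply: ord3P; rewrite !dot3E !mxE /=; ring.
rewrite rpredB ?dvdz_mulr // cE.
suff -> : cross x (p%:Z *: c) = p%:Z *: cross x c by rewrite mxE dvdz_mulr.
by apply/rowP; apply: ord3P; rewrite !mxE /=; ring.
Qed.

Lemma axis_similitude (R : 'M[int]_3) (c m : int) x :
  R *m R^T = (c ^+ 2)%:M -> axis m x -> axis (c * m) (x *m R).
Proof.
move=> RR [u [Nu xu]]; exists (u *m R).
by rewrite /norm !(dot_similitude _ _ RR) -/(norm u) Nu xu mulr0 exprMn.
Qed.

Lemma squarefree_axis n : squarefree n ->
  (forall x, norm x = n -> axis 1 x) ->
  forall (m : nat) x, (0 < m)%N -> norm x = (n * m ^ 2)%N -> axis m x.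
Proof.
move=> sf H; elim/ltn_ind => m IH x m0 Nx.
have [m1|m1] := eqVneq m 1%N.
  by rewrite m1; apply: H; rewrite Nx m1 muln1.
have pp := pdiv_prime (_ : 1 < m)%N.
have {}pp : prime (pdiv m) by apply: pp; lia.
have [m' mE] := dvdnP (pdiv_dvd m); move: (pdiv m) pp mE => p pp mE.
have p1 := prime_gt1 pp.
have {}Nx : norm x = p%:Z ^+ 2 * (n * m' ^ 2)%N.
  by rewrite Nx mE; lia.
have [|R [x' [RR xE]]] := @similitude_factor p x pp.
  by rewrite Nx dvdz_mulr.
rewrite xE mE PoszM mulrC; apply: axis_similitude => //; apply: IH.
- nia.
- lia.
apply: (@mulfI _ (p%:Z ^+ 2)); first by rewrite expf_neq0; lia.
by rewrite -Nx xE /norm (dot_similitude _ _ RR).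
Qed.

(** * Lifting vectors without twins *)

(** Column [j] of [R] is a vector [h], isotropic modulo [p], whose product with [x] is [(x R)_j],
    hence prime to [p]. So [isotropic_orthogonal] applies to [y = u R^T], and again to [y / p],
    making [y] divisible by [p^2]. *)
Lemma axis_descent (p : nat) (m : int) (R : 'M[int]_3) x j : prime p ->
    R *m R^T = (p%:Z ^+ 2)%:M -> R^T *m R = (p%:Z ^+ 2)%:M ->
    ~~ (p %| (x *m R) ord0 j)%Z ->
  axis (p%:Z * m) (x *m R) -> axis m x.
Proof.
move=> pp RR RTR Dxj [u [Nu xu]].
have p0 : p%:Z != 0 by rewrite eqz_nat -lt0n prime_gt0.
have RTTR : R^T *m R^T^T = (p%:Z ^+ 2)%:M by rewrite trmxK.
pose h : 'rV[int]_3 := delta_mx 0 j *m R^T; pose y := u *m R^T.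
have Nh : norm h = p%:Z ^+ 2 * norm (delta_mx 0 j).
  by rewrite /norm (dot_similitude _ _ RTTR).
have Dh : (p %| norm h)%Z by rewrite Nh expr2 -mulrA dvdz_mulr.
have Dhx : ~~ (p %| dot h x)%Z.
  rewrite /h dot_mulmx trmxK; move: Dxj; congr (~~ (_ %| _)%Z).
  by move: j {h Nh Dh}; apply: ord3P; rewrite dot3E !mxE /=; ring.
have Dxy : dot x y = 0 by rewrite /y -dot_mulmx.
have Ny : norm y = p%:Z ^+ 2 * norm u.
  by rewrite /norm (dot_similitude _ _ RTTR).
have Dhy : dot h y = p%:Z ^+ 2 * dot (delta_mx 0 j) u.
  by rewrite (dot_similitude _ _ RTTR).
have : vdvd p y.
  apply: (@isotropic_orthogonal p h y x) => //.
  - by rewrite Ny expr2 -mulrA dvdz_mulr.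
  - by rewrite Dhy expr2 -mulrA dvdz_mulr.
  - by rewrite Dxy dvdz0.
case/vdvdP=> z yE.
have Nz : norm z = norm u.
  by apply: (@mulfI _ (p%:Z ^+ 2)); rewrite ?expf_neq0 // -normZ -yE Ny.
have xz : dot x z = 0 by apply: (mulfI p0); rewrite -dotZr -yE Dxy mulr0.
have : vdvd p z.
  apply: (@isotropic_orthogonal p h z x) => //.
  - by rewrite Nz Nu exprMn expr2 -mulrA dvdz_mulr.
  - have -> : dot h z = p%:Z * dot (delta_mx 0 j) u.
      by apply: (mulfI p0); rewrite -[LHS]dotZr -yE Dhy expr2 mulrA.
    by rewrite dvdz_mulr.
  - by rewrite xz dvdz0.
case/vdvdP=> w zE; exists w; split.
  apply: (@mulfI _ (p%:Z ^+ 2)); rewrite ?expf_neq0 //.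
  by rewrite -normZ -zE Nz Nu exprMn.
by apply: (mulfI p0); rewrite -dotZr -zE xz mulr0.
Qed.

Lemma axis_orthogonal (m : int) (A : 'M[int]_3) x :
  A *m A^T = 1%:M -> axis m (x *m A) -> axis m x.
Proof.
move=> AA /(@axis_similitude A^T 1 m); rewrite expr1n trmxK (mulmx1C AA) mul1r.
by rewrite -mulmxA AA mulmx1; apply.
Qed.

Lemma vdvd_mulmx d x (A : 'M[int]_3) : vdvd d x -> vdvd d (x *m A).
Proof.
by case/vdvdP=> y ->; apply/vdvdP; exists (y *m A); rewrite scalemxAl.
Qed.

(** The invariant of the ascent; it leaves out 2 because the step for that prime doubles the
    vector. *)
Definition odd_primitive (x : 'rV[int]_3) :=
  forall p : nat, prime p -> odd p -> ~~ vdvd p x.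

(* Permuting the coordinates of [x] moves a nonzero one in front of a nonzero
   row of [R]; if [x R] then still vanishes modulo [p], a change of sign of that
   coordinate prevents it. *)
Lemma exists_orthogonal_nonzero (p : nat) (R : 'M[int]_3) x :
    prime p -> odd p ->
    (exists i j, ~~ (p %| R i j)%Z) -> ~~ vdvd p x ->
  exists A j, A *m A^T = 1%:M /\ ~~ (p %| (x *m A *m R) ord0 j)%Z.
Proof.
move=> pp op [i [j Rij]] /forallPn[k xk].
pose T : 'M[int]_3 := tperm_mx i k.
have TT : T *m T^T = 1%:M by rewrite tr_tperm_mx -perm_mxM tperm2 perm_mx1.
have : (x *m T) 0 i = x 0 k by rewrite -xcolE mxE tpermL.
move yE : (x *m T) => y yi.
have [Dj|] := boolP (p %| (y *m R) ord0 j)%Z; last by exists T, j; rewrite yE.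
pose S : 'M[int]_3 := 1%:M - 2 *: delta_mx i i.
have SS : S *m S^T = 1%:M.
  have -> : S^T = S by apply/matrixP=> a b; rewrite !mxE (eq_sym b) andbC.
  rewrite /S mulmxBl !mulmxBr !mul1mx mulmx1.
  rewrite -scalemxAl -scalemxAr mul_delta_mx.
  by apply/matrixP=> a b; rewrite !mxE; ring.
exists (T *m S), j; split.
  by rewrite trmx_mul mulmxA -(mulmxA T) SS mulmx1.
have -> : (x *m (T *m S) *m R) ord0 j = (y *m R) ord0 j - 2 * (y 0 i * R i j).
  rewrite mulmxA yE /S; move: i {Rij T TT yi yE S SS}; apply: ord3P;
    rewrite !(mxE, big_ord3) /=; ring.
rewrite rpredBl // odd_prime_dvdz2 // prime_dvdzM // negb_or Rij andbT yi.
exact: xk.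
Qed.

Lemma axis_ascent (m : nat) x : (0 < m)%N -> odd_primitive x ->
  exists y, [/\ norm y = norm x * m%:Z ^+ 2, odd_primitive y &
    axis m y -> axis 1 x].
Proof.
elim/ltn_ind: m x => m IH x m0 Px.
have [->|m1] := eqVneq m 1%N; first by exists x; rewrite mulr1.
have pp : prime (pdiv m) by apply: pdiv_prime; lia.
have [m' mE] := dvdnP (pdiv_dvd m); move: (pdiv m) pp mE => p pp mE.
have p1 := prime_gt1 pp.
have p0 : p%:Z != 0 by lia.
have [||y [Ny Py Ay]] := IH m' _ x _ Px; [nia | lia |].
have mzE : m%:Z = p%:Z * m'%:Z by rewrite mE PoszM mulrC.
have [p2|op] := even_prime pp.
  exists (p%:Z *: y); split.
  - by rewrite normZ Ny mzE; ring.
  - move=> q qp oq; apply/negP=> /forallP D; case/negP: (Py q qp oq).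
    by apply/forallP=> i; move: (D i); rewrite mxE p2 odd_prime_dvdz2.
  case=> u [Nu yu]; apply: Ay.
  (* The norm of [u] is a multiple of 4, so [u] is even, and its half witnesses the axis of [y]. *)
  have /vdvdP[v uE] : vdvd p u.
    rewrite p2; have : (4 %| norm u)%Z by rewrite Nu mzE p2 exprMn dvdz_mulr.
    rewrite /norm dot3E -!expr2 => /sum3sqr_mod4[D0 D1 D2].
    by apply/forallP; apply: ord3P.
  exists v; split.
    apply: (@mulfI _ (p%:Z ^+ 2)); rewrite ?expf_neq0 //.
    by rewrite -normZ -uE Nu mzE exprMn.
  by apply: (mulfI p0); apply: (mulfI p0); rewrite -dotZl -dotZr -uE yu !mulr0.
have [R [RR RTR Rij]] := exists_similitude pp op.
have [A [j [AA Dj]]] := exists_orthogonal_nonzero pp op Rij (Py p pp op).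
exists (y *m A *m R); split.
- rewrite /norm (dot_similitude _ _ RR) (dot_similitude _ _ AA) -/(norm y).
  by rewrite Ny mzE; ring.
- move=> q qp oq; have [->|npq] := eqVneq q p.
    by apply/negP=> /forallP/(_ j); rewrite (negbTE Dj).
  (* A prime [q != p] dividing [y A R] would divide [y A R R^T = p^2 y A], hence [y]. *)
  apply/negP=> /(vdvd_mulmx R^T); rewrite -mulmxA RR mul_mx_scalar => D.
  case/negP: (Py q qp oq).
  suff /(vdvd_mulmx A^T) : vdvd q (y *m A) by rewrite -mulmxA AA mulmx1.
  apply/forallP=> i; move/forallP/(_ i): D.
  rewrite mxE prime_dvdzM // prime_dvdz_sqr // => /orP[|//].
  by rewrite dvdzE /= dvdn_prime2 // (negbTE npq).
by rewrite mzE => /(axis_descent pp RR RTR Dj)/(axis_orthogonal AA)/Ay.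
Qed.

Lemma squarefree_odd_primitive n x :
  squarefree n -> norm x = n -> odd_primitive x.
Proof.
move=> sf Nx p pp _; apply/negP=> /vdvdP[y xE].
suff : p = 1%N by move=> p1; rewrite p1 in pp.
apply: sf; suff : (p%:Z ^+ 2 %| n%:Z)%Z by rewrite dvdzE abszX.
by rewrite -Nx xE normZ dvdz_mulr.
Qed.

(** Stripping one similitude for each prime of [m] carries representability as a norm down to the
    squarefree part. *)
Lemma norm_descent (n m : nat) x : (0 < m)%N ->
  norm x = (n * m ^ 2)%N -> exists y, norm y = n.
Proof.
elim/ltn_ind: m x => m IH x m0 Nx.
have [m1|m1] := eqVneq m 1%N; first by exists x; rewrite Nx m1 muln1.
have pp : prime (pdiv m) by apply: pdiv_prime; lia.
have [m' mE] := dvdnP (pdiv_dvd m); move: (pdiv m) pp mE => p pp mE.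
have p1 := prime_gt1 pp.
have {}Nx : norm x = p%:Z ^+ 2 * (n * m' ^ 2)%N by rewrite Nx mE; lia.
have [|R [y [RR xE]]] := @similitude_factor p x pp.
  by rewrite Nx dvdz_mulr.
apply: (IH m' _ y); [nia | lia |].
apply: (@mulfI _ (p%:Z ^+ 2)); first by rewrite expf_neq0; lia.
by rewrite -Nx xE /norm (dot_similitude _ _ RR).
Qed.

(** * Twin-completeness and squarefree parts *)

Lemma twin_axis1 n x : squarefree n -> norm x = n ->
  (exists y, twins x y) <-> axis 1 x.
Proof. by move=> sf Nx; apply: (@twin_axis n 1%N) => //; rewrite muln1. Qed.

Lemma twin_complete_squarefree_part (M n : nat) : (0 < M)%N ->
  squarefree_part M n -> twin_complete M <-> twin_complete n.
Proof.
move=> M0 [sf [m ME]].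
have m0 : (0 < m)%N by move: M0; rewrite ME muln_gt0 expn_gt0 orbF => /andP[].
split=> -[tw [x Nx]]; split.
- move=> v Nv; apply/(twin_axis1 sf Nv).
  (* A vector [v] of norm [n] is lifted to norm [M]; the twin found there gives an axis that
     descends to [v]. *)
  have [y [Ny _ Ay]] := axis_ascent m0 (squarefree_odd_primitive sf Nv).
  have NyM : norm y = (n * m ^ 2)%N by rewrite Ny Nv; lia.
  by apply: Ay; apply/(twin_axis sf m0 NyM); apply: tw; rewrite NyM ME.
- by apply: (@norm_descent n m x m0); rewrite Nx ME.
- move=> y Ny; have {}Ny : norm y = (n * m ^ 2)%N by rewrite Ny ME.
  apply/(twin_axis sf m0 Ny); apply: (squarefree_axis sf) => // z Nz.
  by apply/(twin_axis1 sf Nz); apply: tw.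
by exists (m%:Z *: x); rewrite normZ Nx ME; lia.
Qed.

(** By [twin_axis1] and [axis1], twin-completeness says that vectors of norm [n] exist and that each
    has a zero coordinate. *)
Lemma twin_complete_squarefree n : squarefree n -> twin_complete n <->
  (exists k, (k <= 2)%N /\ sum_of_pos_squares k n) /\ ~ sum_of_pos_squares 3 n.
Proof.
have sum3 (a : 'I_3 -> nat) :
    (\sum_i a i ^ 2 = a 0%R ^ 2 + a 1%R ^ 2 + a 2%R ^ 2)%N.
  rewrite !big_ord_recr big_ord0 /= add0n.
  by congr (a _ ^ 2 + a _ ^ 2 + a _ ^ 2)%N; apply: val_inj.
move=> sf; split.
- case=> tw [x Nx]; have zero y : norm y = n -> exists i, y 0 i = 0.
    by move=> Ny; apply/axis1/(twin_axis1 sf Ny)/tw.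
  split; last first.
    case=> a [a0 nE]; have [] := zero (\row_i (a i)%:Z).
      by rewrite /norm dot3E !mxE nE sum3; lia.
    by move=> i; rewrite mxE; have := a0 i; lia.
  have [a [b nE]] : exists a b : nat, n = (a ^ 2 + b ^ 2)%N.
    have [i xi] := zero x Nx; move: Nx; rewrite /norm dot3E.
    by move: i xi; apply: ord3P => -> Nx;
      [exists `|x 0%R 1%R|%N, `|x 0%R 2%R|%N
      | exists `|x 0%R 0%R|%N, `|x 0%R 2%R|%N
      | exists `|x 0%R 0%R|%N, `|x 0%R 1%R|%N]; lia.
  (* The larger root is positive, so whether [b] vanishes decides between one square and two. *)
  wlog ab : a b nE / (b <= a)%N.
    by move=> W; case: (leqP b a) => [|/ltnW]; apply: W; rewrite // addnC.
  have a0 : (0 < a)%N.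
    rewrite lt0n; apply/eqP=> a0; move: (squarefree_gt0 sf).
    by move: ab; rewrite nE a0 leqn0 => /eqP->.
  have [b0|b0] := posnP b.
    by exists 1%N; split=> //; exists (fun=> a); rewrite big_ord1 nE b0 addn0.
  exists 2%N; split=> //; exists (fun i => nth 0%N [:: a; b] i); split.
    by case=> [[|[|//]]].
  by rewrite !big_ord_recr big_ord0.
case=> -[k [k2 [a [a0 nE]]]] not3; split.
  move=> x Nx; apply/(twin_axis1 sf Nx)/axis1.
  have [/existsP[i /eqP]|] := boolP [exists i, x 0 i == 0]; first by exists i.
  move/existsPn=> x0; case: not3; exists (fun i => `|x 0%R i|%N); split.
    by move=> i; rewrite absz_gt0.
  by rewrite sum3; have := Nx; rewrite /norm dot3E; lia.
(* Fewer than two squares are padded with zeros. *)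
have [c [d ->]] : exists c d : nat, n = (c ^ 2 + d ^ 2)%N.
  move: k2 a a0 nE; case: k => [|[|[|//]]] _ a _ ->.
  - by exists 0%N, 0%N; rewrite big_ord0.
  - by exists (a 0), 0%N; rewrite big_ord1 addn0.
  - exists (a 0), (a 1); rewrite big_ord_recr big_ord1.
    by congr (a _ ^ 2 + a _ ^ 2)%N; apply: val_inj.
by exists (vec3 c d 0); rewrite /norm dot3E !mxE /=; lia.
Qed.

Local Close Scope ring_scope.

Theorem theorem1p8 :
  (forall M n : nat, 0 < M -> squarefree_part M n ->
     (twin_complete M <-> twin_complete n))
  /\
  (forall n : nat, 0 < n -> squarefree n ->
     (twin_complete n <->
        (exists k : nat, k <= 2 /\ sum_of_pos_squares k n)
        /\ ~ sum_of_pos_squares 3 n)).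
Proof.
split; first exact: twin_complete_squarefree_part.
by move=> n _; exact: twin_complete_squarefree.
Qed.
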